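(* Let $f_1,\dots,f_m:\mathbb{R}^n\to\mathbb{R}$ be differentiable functions with $L$-Lipschitz continuous gradients. Let $(x_k)_{k\ge1}$ be a sequence of non-critical points of $\mathbb{R}^n$ converging to $x_\infty\in\mathbb{R}^n$. Suppose that for no $i\in\{1,\dots,m\}$ does $\nabla f_i(x_k)$ go to zero as $k\to\infty$. Then either (i) $x_\infty$ is critical and $\|V_c(x_k)\|\to\infty$ as $k\to\infty$; or (ii) $x_\infty$ is not critical and $V_c(x_k)$ converges to $V_c(x_\infty)$ as $k\to\infty$.
   Context: $\|\cdot\|$ is the Euclidean norm. $L$-Lipschitz gradients means that for some $L\ge0$, $\|\nabla f_i(x)-\nabla f_i(y)\|\le L\|x-y\|$ for all $x,y\in\mathbb{R}^n$ and all $i$. A point $x\in\mathbb{R}^n$ is critical if there does not exist $v\in\mathbb{R}^n$ such that $\nabla f_i(x)^Tv<0$ for all $i=1,\dots,m$. Central descent direction: $V_c(x)$ is the unique minimizer of $\tfrac12\|V\|^2$ over all $V\in\mathbb{R}^n$ satisfying $\nabla f_i(x)^T V\le -\|\nabla f_i(x)\|$ for all $i=1,\dots,m$; it exists at every non-critical point $x$. *)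

(* Defs.v *)
From HB Require Import structures.
From mathcomp Require Import all_boot all_order all_algebra.
From mathcomp Require Import all_classical all_reals all_analysis.
Set Implicit Arguments.
Unset Strict Implicit.
Unset Printing Implicit Defensive.
Import Order.TTheory GRing.Theory Num.Theory.
Import numFieldNormedType.Exports.
Local Open Scope classical_set_scope.
Local Open Scope ring_scope.

Definition dotv (R : realType) (n : nat) (u v : 'rV[R]_n) : R := (u *m v^T) 0 0.

(* The library norm `|v| on 'rV[R]_n is the sup norm, hence this definition;
   both norms induce the same topology. *)
Definition enorm (R : realType) (n : nat) (v : 'rV[R]_n) : R :=
  Num.sqrt (dotv v v).

Definition grad (R : realType) (n : nat) (f : 'rV[R]_n -> R) (x : 'rV[R]_n) :
    'rV[R]_n :=
  \row_j 'D_(delta_mx 0 j) f x.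

Definition lipschitz_grad (R : realType) (n : nat) (L : R)
    (f : 'rV[R]_n -> R) : Prop :=
  forall x y : 'rV[R]_n, enorm (grad f x - grad f y) <= L * enorm (x - y).

Definition critical (R : realType) (n m : nat) (f : 'I_m -> 'rV[R]_n -> R)
    (x : 'rV[R]_n) : Prop :=
  ~ exists v : 'rV[R]_n, forall i : 'I_m, dotv (grad (f i) x) v < 0.

Definition central_feasible (R : realType) (n m : nat)
    (f : 'I_m -> 'rV[R]_n -> R) (x : 'rV[R]_n) : set 'rV[R]_n :=
  [set V | forall i : 'I_m, dotv (grad (f i) x) V <= - enorm (grad (f i) x)].

Definition central_minimizer (R : realType) (n m : nat)
    (f : 'I_m -> 'rV[R]_n -> R) (x : 'rV[R]_n) : set 'rV[R]_n :=
  [set V | central_feasible f x V /\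
    forall W, central_feasible f x W ->
      2^-1 * enorm V ^+ 2 <= 2^-1 * enorm W ^+ 2].

(* The minimizer is unique when it exists (strictly convex objective, convex
   feasible set), and it exists at every non-critical x; the default value 0 of
   xget is taken only where the feasible set is empty. *)
Definition Vc (R : realType) (n m : nat) (f : 'I_m -> 'rV[R]_n -> R)
    (x : 'rV[R]_n) : 'rV[R]_n :=
  xget 0 (central_minimizer f x).

(* Main.v *)
Require Import Defs.
From HB Require Import structures.
From mathcomp Require Import all_boot all_order all_algebra.
From mathcomp Require Import all_classical all_reals all_analysis.
From mathcomp Require Import ring lra.
Import Order.TTheory GRing.Theory Num.Theory.
Import numFieldNormedType.Exports.
Local Open Scope classical_set_scope.
Local Open Scope ring_scope.

(** The idea is that the constraints defining V_c are stable under small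
    relative perturbations of the gradients. Lipschitz continuity gives
    grad f_i (x_k) --> grad f_i (xoo), so the hypothesis that no gradient
    sequence tends to 0 says exactly that every limit gradient is nonzero; hence
    for each e > 0 the gradients at x_k and at xoo eventually differ by at most
    e times the norm of either one ([rel_close], [cvg_rel_close]). If V, of norm
    at most M, is feasible for one of two such families, then V divided by
    1 - e (1 + M) is feasible for the other ([descent_region_rescale]).

    If xoo is critical, a bound |V_c(x_k)| <= M at some far k would, by
    rescaling, yield a feasible vector at xoo, which makes all the directional
    derivatives there negative since no gradient vanishes: a contradiction. So
    |V_c(x_k)| eventually exceeds every M.

    If xoo is not critical, rescaling is used in both directions. From
    V := V_c(xoo) to the region at x_k it bounds |V_c(x_k)|; from V_c(x_k) to the
    region at xoo it produces a competitor of V, on which the projection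
    inequality for the point of least norm of a convex set applies
    ([least_norm_dotv]). Together they give the explicit estimate
      |V_c(x_k) - V|^2 <= 8 e (1 + 2 |V|) |V|^2
    ([least_norm_stable]), hence convergence without extracting subsequences.
    Compactness enters only in the existence of the points of least norm
    ([least_norm_exists]). *)

(** * The Euclidean norm and its comparison with the sup norm *)

Section DotProduct.
Context {R : realType} {n : nat}.
Implicit Types (u v w : 'rV[R]_n) (a : R).

Lemma dotvE u v : dotv u v = \sum_j u 0 j * v 0 j.
Proof. by rewrite /dotv !mxE; apply: eq_bigr => j _; rewrite mxE. Qed.

Lemma dotvC u v : dotv u v = dotv v u.
Proof. by rewrite !dotvE; apply: eq_bigr => j _; rewrite mulrC. Qed.

Lemma dotvDl u v w : dotv (u + v) w = dotv u w + dotv v w.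
Proof. by rewrite /dotv mulmxDl mxE. Qed.

Lemma dotvZl a u v : dotv (a *: u) v = a * dotv u v.
Proof. by rewrite /dotv -scalemxAl mxE. Qed.

Lemma dotvDr u v w : dotv u (v + w) = dotv u v + dotv u w.
Proof. by rewrite dotvC dotvDl !(dotvC u). Qed.

Lemma dotvZr a u v : dotv u (a *: v) = a * dotv u v.
Proof. by rewrite dotvC dotvZl dotvC. Qed.

Lemma dotvNl u v : dotv (- u) v = - dotv u v.
Proof. by rewrite -scaleN1r dotvZl mulN1r. Qed.

Lemma dotvNr u v : dotv u (- v) = - dotv u v.
Proof. by rewrite dotvC dotvNl dotvC. Qed.

Definition dotv_lin := (dotvDl, dotvDr, dotvZl, dotvZr, dotvNl, dotvNr).

Lemma dotvv_ge0 u : 0 <= dotv u u.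
Proof. by rewrite dotvE sumr_ge0// => j _; rewrite -expr2 sqr_ge0. Qed.

Lemma enorm_ge0 u : 0 <= enorm u.
Proof. exact: sqrtr_ge0. Qed.

Lemma enorm_sqr u : enorm u ^+ 2 = dotv u u.
Proof. by rewrite sqr_sqrtr// dotvv_ge0. Qed.

Lemma enorm0 : enorm (0 : 'rV[R]_n) = 0.
Proof. by rewrite /enorm /dotv mul0mx mxE sqrtr0. Qed.

Lemma enormZ a u : 0 <= a -> enorm (a *: u) = a * enorm u.
Proof.
move=> a0; apply/eqP; rewrite -(eqrXn2 (n := 2))// ?mulr_ge0 ?enorm_ge0//.
by rewrite exprMn !enorm_sqr !dotv_lin mulrA.
Qed.

Lemma enormN u : enorm (- u) = enorm u.
Proof. by rewrite /enorm !dotv_lin opprK. Qed.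

Lemma enormB u v : enorm (u - v) = enorm (v - u).
Proof. by rewrite -enormN opprB. Qed.

(** Each squared coordinate is one term of the sum of squares. This is the half
    of the equivalence with the topology-defining sup norm that needs an
    estimate; the other half is continuity of the Euclidean norm. *)
Lemma norm_le_enorm u : `|u| <= enorm u.
Proof.
rewrite [leLHS]/Num.Def.normr/= mx_normrE bigmax_le ?enorm_ge0//= => -[i j] _ /=.
rewrite -(ler_pXn2r (n := 2)) ?nnegrE ?enorm_ge0// real_normK ?num_real//.
rewrite enorm_sqr dotvE (bigD1 j)//= !ord1 expr2 lerDl sumr_ge0// => k _.
by rewrite -expr2 sqr_ge0.
Qed.

Lemma enorm_eq0 u : enorm u = 0 -> u = 0.
Proof.
by move=> u0; apply/normr0_eq0/eqP; rewrite eq_le normr_ge0 -u0 norm_le_enorm.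
Qed.

Lemma enorm_gt0 u : u != 0 -> 0 < enorm u.
Proof.
move=> u0; rewrite lt_neqAle enorm_ge0 andbT eq_sym.
by apply: contra u0 => /eqP/enorm_eq0/eqP.
Qed.

(** Cauchy-Schwarz, from the nonnegativity of the squared norm of the component
    of u orthogonal to v, cleared of its denominator [dotv v v]. *)
Lemma dotv_le_enorm u v : dotv u v <= enorm u * enorm v.
Proof.
have [->|/enorm_gt0 v0] := eqVneq v 0.
  by rewrite -(scale0r 0) dotvZr mul0r scale0r enorm0 mulr0.
have [|/ltW d0] := leP (dotv u v) 0.
  by move=> /le_trans; apply; rewrite mulr_ge0 ?enorm_ge0.
rewrite -(ler_pXn2r (n := 2)) ?nnegrE ?mulr_ge0 ?enorm_ge0// exprMn !enorm_sqr.
have v2 : 0 < dotv v v by rewrite -enorm_sqr exprn_gt0.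
rewrite -subr_ge0 -(pmulr_rge0 _ v2).
have := dotvv_ge0 (dotv v v *: u - dotv u v *: v).
rewrite !dotv_lin (dotvC v u); set a := dotv u u; set b := dotv v v.
set c := dotv u v => h; apply: le_trans h _.
by rewrite le_eqVlt; apply/orP; left; apply/eqP; ring.
Qed.

Lemma ler_enormD u v : enorm (u + v) <= enorm u + enorm v.
Proof.
rewrite -(ler_pXn2r (n := 2)) ?nnegrE ?addr_ge0 ?enorm_ge0//.
rewrite sqrrD !enorm_sqr !dotv_lin (dotvC v u).
by have := dotv_le_enorm u v; lra.
Qed.

Lemma continuous_dotv (h k : 'rV[R]_n -> 'rV[R]_n) :
  continuous h -> continuous k -> continuous (fun x => dotv (h x) (k x)).
Proof.
move=> ch ck; rewrite (funext (fun x => dotvE (h x) (k x))).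
apply: continuous_big => [|j _ x]; first exact: add_continuous.
have coordj (l : 'rV[R]_n -> 'rV[R]_n) : continuous l ->
    l y 0 j @[y --> x] --> l x 0 j.
  by move=> cl; apply: (continuous_cvg _ (@coord_continuous _ _ _ 0 j _) (cl x)).
exact: cvgM (coordj h ch) (coordj k ck).
Qed.

Lemma continuous_enorm : continuous (@enorm R n).
Proof.
have idc : continuous (@id 'rV[R]_n) by move=> v; exact: cvg_id.
move=> u; apply: (continuous_comp (f := fun v => dotv v v)).
  exact: (continuous_dotv _ _ idc idc).
exact: sqrt_continuous.
Qed.

(** Transfers convergence for the sup norm, which defines the topology, to the
    Euclidean norm, in which all the estimates below are made. *)
Lemma cvg_enormP {T : Type} {F : set_system T} {FF : Filter F}
    (h : T -> 'rV[R]_n) u :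
  h t @[t --> F] --> u <-> enorm (h t - u) @[t --> F] --> 0.
Proof.
split=> [hu|/cvgr0Pnorm_le hu].
  rewrite -enorm0; apply: continuous_cvg; first exact: continuous_enorm.
  exact/subr_cvg0.
apply/subr_cvg0/cvgr0Pnorm_le => e /hu; apply: filterS => t.
by rewrite (ger0_norm (enorm_ge0 _)); apply: le_trans; exact: norm_le_enorm.
Qed.

End DotProduct.

(** * Points of least norm *)

Section LeastNorm.
Context {R : realType} {n : nat}.
Implicit Types (A : set 'rV[R]_n) (V W : 'rV[R]_n).

Definition least_norm A V := A V /\ forall W, A W -> enorm V <= enorm W.

(** Cutting A with a closed ball through one of its points keeps every candidate
    minimizer and makes the set compact. *)
Lemma least_norm_exists A : A !=set0 -> closed A -> exists V, least_norm A V.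
Proof.
move=> [V0 AV0] clA.
pose B := A `&` (@enorm R n) @^-1` [set r | r <= enorm V0].
have B0 : B !=set0 by exists V0; split => //=.
have cB : compact B.
  apply: bounded_closed_compact.
    exists (enorm V0); split => [|K VK W [_ WV0]]; first exact: num_real.
    exact: le_trans (norm_le_enorm W) (le_trans WV0 (ltW VK)).
  apply: closedI => //; apply: preimage_closed; last exact: closed_le.
  by move=> W _; exact: continuous_enorm.
have [V VB Vmin] := EVT_min_rV B0 cB (continuous_subspaceT continuous_enorm).
move: VB; rewrite inE => -[AV VV0]; exists V; split => // W AW.
have [WV0|/ltW V0W] := leP (enorm W) (enorm V0).
  by apply: Vmin; rewrite inE.
exact: le_trans VV0 V0W.
Qed.

(** The projection inequality: moving from V towards W must not decrease the
    norm, so the derivative at V of half the squared norm in direction W - V,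
    namely [dotv V W - dotv V V], is nonnegative. *)
Lemma least_norm_dotv A V W : least_norm A V ->
  (forall t, 0 <= t <= 1 -> A (V + t *: (W - V))) ->
  enorm V ^+ 2 <= dotv V W.
Proof.
move=> [AV Vmin] segA; rewrite enorm_sqr leNgt; apply/negP => VW.
set b := dotv (W - V) (W - V); pose a := dotv V V - dotv V W.
have b0 : 0 <= b := dotvv_ge0 _.
have a0 : 0 < a by rewrite subr_gt0.
have ab0 : 0 < a + b by rewrite ltr_wpDr.
(* At time t the squared norm is |V|^2 - t (2 a - t b); this t lies in ]0, 1]
   and makes t b < 2 a, so the norm would drop below that of V. *)
pose t := a / (a + b).
have t0 : 0 < t by rewrite divr_gt0.
have t1 : t * (a + b) = a by rewrite divfK ?gt_eqF.
have tI : 0 <= t <= 1 by rewrite ltW//= ler_pdivrMr// mul1r lerDl.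
have := Vmin _ (segA _ tI).
rewrite -(ler_pXn2r (n := 2)) ?nnegrE ?enorm_ge0// !enorm_sqr.
have -> : dotv (V + t *: (W - V)) (V + t *: (W - V)) =
    dotv V V - t * (2 * a - t * b).
  by rewrite /a /b !dotv_lin (dotvC W V); ring.
apply/negP; rewrite -ltNge gtrBl mulr_gt0//.
have -> : 2 * a - t * b = a + t * a by move: t1; lra.
by rewrite addr_gt0// mulr_gt0.
Qed.

End LeastNorm.

(** * Stability of the feasible region and of its point of least norm *)

Section DescentRegion.
Context {R : realType} {n m : nat}.
Implicit Types (g h : 'I_m -> 'rV[R]_n) (V W v : 'rV[R]_n) (e M : R).

(** The central feasible set depends on the functions and the point only through
    the family g of gradients; isolating g allows comparing the regions at two
    different points. *)
Definition descent_region g : set 'rV[R]_n :=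
  [set V | forall i, dotv (g i) V <= - enorm (g i)].

Lemma descent_region_closed g : closed (descent_region g).
Proof.
have -> : descent_region g =
    \bigcap_i dotv (g i) @^-1` [set r | r <= - enorm (g i)].
  apply/seteqP; split => [V gV i _|V gV i]; first exact: gV.
  exact: (gV i Logic.I).
apply: closed_bigI => i _; apply: preimage_closed; last exact: closed_le.
have gc : continuous (fun _ : 'rV[R]_n => g i) by exact: cst_continuous.
have idc : continuous (@id 'rV[R]_n) by move=> V; exact: cvg_id.
by move=> V _; exact: (continuous_dotv _ _ gc idc).
Qed.

Lemma descent_region_convex g V W t : descent_region g V ->
  descent_region g W -> 0 <= t <= 1 -> descent_region g (V + t *: (W - V)).
Proof.
move=> gV gW /andP[t0 t1] i; rewrite !dotv_lin.
by have := gV i; have := gW i; nra.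
Qed.

(** Scaling a common descent direction v by the sum over j of
    |g_j| / - <g_j, v> meets all the constraints at once, the i-th summand
    sufficing for the i-th constraint. *)
Lemma descent_region_nonempty g v :
  (forall i, dotv (g i) v < 0) -> descent_region g !=set0.
Proof.
move=> gv; have c0 j : 0 <= enorm (g j) / - dotv (g j) v.
  by rewrite divr_ge0 ?enorm_ge0// oppr_ge0 ltW.
exists ((\sum_j enorm (g j) / - dotv (g j) v) *: v) => i.
rewrite dotvZr lerNr -mulrN -ler_pdivrMr ?oppr_gt0//.
by rewrite (bigD1 i)//= lerDl sumr_ge0.
Qed.

(** Relative closeness fits constraints homogeneous in the gradients: it avoids
    normalizing them. Both bounds are asked for so that the relation is
    symmetric, as rescaling is used in both directions. *)
Definition rel_close e g h := forall i,
  enorm (g i - h i) <= e * enorm (g i) /\ enorm (g i - h i) <= e * enorm (h i).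

Lemma rel_closeC e g h : rel_close e g h -> rel_close e h g.
Proof. by move=> gh i; rewrite enormB; case: (gh i). Qed.

(** Replacing g_i by h_i costs at most |g_i - h_i| |V| in the scalar product and
    |g_i - h_i| in the right-hand side, so that <h_i, V> is at most
    - |h_i| + e |h_i| (1 + M); the factor 1 - e (1 + M) is then divided out. *)
Lemma descent_region_rescale e g h V M : rel_close e g h ->
  descent_region g V -> enorm V <= M -> 0 < 1 - e * (1 + M) ->
  descent_region h ((1 - e * (1 + M))^-1 *: V).
Proof.
move=> gh gV VM t0 i; rewrite dotvZr ler_pdivrMl//.
have [_ hi] := gh i; have gi := gV i.
have M0 : 0 <= 1 + M by rewrite addr_ge0// (le_trans (enorm_ge0 V)).
have h1 : dotv (h i) V <= dotv (g i) V + enorm (g i - h i) * M.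
  rewrite -lerBlDl -dotvNl -dotvDl; apply: le_trans (dotv_le_enorm _ _) _.
  by rewrite enormB ler_wpM2l ?enorm_ge0.
have h2 : enorm (h i) <= enorm (g i) + enorm (g i - h i).
  by rewrite -{1}(subrKC (g i) (h i)) (le_trans (ler_enormD _ _))// (enormB (h i)).
have h3 : enorm (g i - h i) * (1 + M) <= e * enorm (h i) * (1 + M).
  exact: ler_wpM2r.
lra.
Qed.

(** Put r := e (1 + 2 |V|). Rescaling V into the region of h shows that
    (1 - r) |V'| <= |V|, so |V'| <= 2 |V|; hence V' / (1 - r) is in the region
    of g, and the projection inequality gives (1 - r) |V|^2 <= <V, V'>. Expanding
    |V' - V|^2 and using 1 / (1 - r)^2 <= 1 + 6 r for r <= 1/2 leaves
    (6 r + 2 r) |V|^2. *)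
Lemma least_norm_stable e g h V V' : 0 <= e -> rel_close e g h ->
  least_norm (descent_region g) V -> least_norm (descent_region h) V' ->
  e * (1 + 2 * enorm V) <= 2^-1 ->
  enorm (V' - V) ^+ 2 <= 8 * (e * (1 + 2 * enorm V)) * enorm V ^+ 2.
Proof.
move=> e0 gh lV lV'; have [gV Vmin] := lV; have [hV' V'min] := lV'.
have V0 := enorm_ge0 V; have V'0 := enorm_ge0 V'.
set r := e * _ => r2; have r0 : 0 <= r by rewrite /r mulr_ge0//; lra.
have t0 : 0 < 1 - r by lra.
have hV : descent_region h ((1 - r)^-1 *: V).
  by apply: descent_region_rescale gh gV _ _ => //; lra.
have V'V : (1 - r) * enorm V' <= enorm V.
  rewrite -ler_pdivlMl//; apply: le_trans (V'min _ hV) _.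
  by rewrite enormZ// invr_ge0 ltW.
have gV' : descent_region g ((1 - r)^-1 *: V').
  by apply: descent_region_rescale (rel_closeC _ _ _ gh) hV' _ _ => //; nra.
have pV : (1 - r) * enorm V ^+ 2 <= dotv V V'.
  rewrite -ler_pdivlMl// -dotvZr; apply: least_norm_dotv lV _ => t.
  exact: descent_region_convex.
have sV : (1 - r) ^+ 2 * enorm V' ^+ 2 <= enorm V ^+ 2.
  by rewrite -exprMn ler_pXn2r ?nnegrE// mulr_ge0// ltW.
have cr : 1 <= (1 + 6 * r) * (1 - r) ^+ 2.
  have -> : (1 + 6 * r) * (1 - r) ^+ 2 =
    1 + r * (1 - 2 * r) * (4 - 3 * r) by ring.
  rewrite lerDl mulr_ge0 ?mulr_ge0//; lra.
have V'2 : enorm V' ^+ 2 <= (1 + 6 * r) * enorm V ^+ 2.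
  apply: le_trans (_ : (1 + 6 * r) * ((1 - r) ^+ 2 * enorm V' ^+ 2) <= _).
    by rewrite mulrA ler_peMl ?sqr_ge0.
  by rewrite ler_wpM2l//; lra.
rewrite enorm_sqr !dotv_lin (dotvC V' V) -!enorm_sqr; lra.
Qed.

End DescentRegion.

(** * The central descent direction along a sequence of points *)

Section CentralDirection.
Context {R : realType} {n m : nat}.
Implicit Types (f : 'I_m -> 'rV[R]_n -> R) (x : 'rV[R]_n).

Lemma Vc_least_norm f x : ~ critical f x ->
  least_norm (descent_region (fun i => grad (f i) x)) (Vc f x).
Proof.
move=> /contrapT [v fv].
have /least_norm_exists := descent_region_nonempty _ _ fv.
move=> /(_ (descent_region_closed _)) [V [fV Vmin]].
have Vle W W' : (2^-1 * enorm W ^+ 2 <= 2^-1 * enorm W' ^+ 2) =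
    (enorm W <= enorm W').
  by rewrite ler_pM2l ?invr_gt0// ler_pXn2r ?nnegrE ?enorm_ge0.
have : central_minimizer f x (Vc f x).
  apply: xgetPex; exists V; split => // W fW; rewrite Vle; exact: Vmin.
by move=> [fVc Vcmin]; split => // W /Vcmin; rewrite Vle.
Qed.

Lemma feasible_noncritical f x V : (forall i, grad (f i) x != 0) ->
  descent_region (fun i => grad (f i) x) V -> ~ critical f x.
Proof.
move=> g0 gV; apply; exists V => i; apply: le_lt_trans (gV i) _.
by rewrite oppr_lt0 enorm_gt0.
Qed.

Lemma lipschitz_grad_cvg {T : Type} {F : set_system T} {FF : Filter F} L
    (phi : 'rV[R]_n -> R) (u : T -> 'rV[R]_n) x :
  lipschitz_grad L phi -> u t @[t --> F] --> x ->
  grad phi (u t) @[t --> F] --> grad phi x.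
Proof.
move=> lip /cvg_enormP ux; apply/cvg_enormP.
apply: (@squeeze_cvgr _ _ _ _ (fun=> 0) (fun t => L * enorm (u t - x))).
- by near=> t; rewrite enorm_ge0 lip.
- exact: cvg_cst.
- by rewrite -(mulr0 L); apply: cvgM => //; exact: cvg_cst.
Unshelve. all: by end_near. Qed.

(** A nonzero limit is what turns convergence into relative closeness: once
    |g_i - u_t i| <= e |g_i| / (1 + e), the triangle inequality bounds |u_t i|
    below by |g_i| / (1 + e). *)
Lemma cvg_rel_close {T : Type} {F : set_system T} {FF : Filter F}
    (u : T -> 'I_m -> 'rV[R]_n) (g : 'I_m -> 'rV[R]_n) e :
  (forall i, u t i @[t --> F] --> g i) -> (forall i, g i != 0) -> 0 < e ->
  \forall t \near F, rel_close e g (u t).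
Proof.
move=> ug g0 e0; apply: filter_forall => i.
have gi := enorm_gt0 _ (g0 i); have e1 : 0 < 1 + e by lra.
have /cvg_enormP/cvgr0Pnorm_le/(_ (e * enorm (g i) / (1 + e))) := ug i.
move=> /(_ (divr_gt0 (mulr_gt0 e0 gi) e1)); apply: filterS => t.
rewrite (ger0_norm (enorm_ge0 _)) ler_pdivlMr// enormB => d.
have d0 := enorm_ge0 (g i - u t i).
have := ler_enormD (u t i) (g i - u t i); rewrite subrKC => tri.
by split; nra.
Qed.

End CentralDirection.

Theorem lemma2p2 (R : realType) (n m : nat) (f : 'I_m -> 'rV[R]_n -> R)
    (L : R) (x : nat -> 'rV[R]_n) (xoo : 'rV[R]_n)
    (f_diff : forall (i : 'I_m) (y : 'rV[R]_n), differentiable (f i) y)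
    (L_ge0 : 0 <= L)
    (f_lip : forall i : 'I_m, lipschitz_grad L (f i))
    (x_noncritical : forall k : nat, (1 <= k)%N -> ~ critical f (x k))
    (x_cvg : x k @[k --> \oo] --> xoo)
    (grad_ncvg0 : forall i : 'I_m,
      ~ (grad (f i) (x k) @[k --> \oo] --> (0 : 'rV[R]_n))) :
  (critical f xoo /\ enorm (Vc f (x k)) @[k --> \oo] --> +oo%R) \/
  (~ critical f xoo /\ Vc f (x k) @[k --> \oo] --> Vc f xoo).
Proof.
pose g i := grad (f i) xoo; pose u k i := grad (f i) (x k).
have ug i : u k i @[k --> \oo] --> g i.
  exact: lipschitz_grad_cvg _ _ _ _ (f_lip i) x_cvg.
have g0 i : g i != 0.
  by apply/eqP => gi0; apply: (grad_ncvg0 i); rewrite -gi0; exact: ug.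
have close e : 0 < e -> \forall k \near \oo, rel_close e g (u k).
  exact: cvg_rel_close.
have [cr|ncr] := pselect (critical f xoo); [left|right]; split => //.
- apply/cvgryPge => M.
  have [M0|M0] := leP M 0.
    by apply: nearW => k; exact: le_trans (enorm_ge0 _).
  (* This e makes the rescaling factor 1 - e (1 + M) equal to 1/2. *)
  have e0 : 0 < 2^-1 / (1 + M) by rewrite divr_gt0// addr_gt0.
  near=> k; rewrite leNgt; apply/negP => /ltW VM.
  apply: (feasible_noncritical f xoo) cr => //.
  have [uV _] : least_norm (descent_region (u k)) (Vc f (x k)).
    by apply/Vc_least_norm/x_noncritical; near: k; exact: nbhs_infty_ge.
  apply: descent_region_rescale (rel_closeC _ _ _ _) uV VM _.
    by near: k; exact: close e0.
  rewrite divfK; first by lra.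
  by rewrite gt_eqF// addr_gt0.
- have lV := Vc_least_norm _ _ ncr; set V := Vc f xoo in lV *.
  have V0 := enorm_ge0 V; have a0 : 0 < 1 + 2 * enorm V by lra.
  apply/cvg_enormP/cvgr0Pnorm_le => d d0.
  (* r is the value of e (1 + 2 |V|) in the stability estimate, which then
     reads 8 r |V|^2 <= d ^+ 2; the 1 + avoids dividing by 0 when V = 0. *)
  pose r := Num.min 2^-1 (d ^+ 2 / (8 * (1 + enorm V ^+ 2))).
  have b0 : 0 < 8 * (1 + enorm V ^+ 2).
    by rewrite mulr_gt0// ltr_pwDl ?sqr_ge0.
  have r0 : 0 < r by rewrite lt_min invr_gt0 ltr0n/= divr_gt0// exprn_gt0.
  have e0 := divr_gt0 r0 a0.
  near=> k; rewrite (ger0_norm (enorm_ge0 _)).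
  rewrite -(ler_pXn2r (n := 2)) ?nnegrE ?enorm_ge0 ?(ltW d0)//.
  have lVk : least_norm (descent_region (u k)) (Vc f (x k)).
    by apply/Vc_least_norm/x_noncritical; near: k; exact: nbhs_infty_ge.
  have gu : rel_close (r / (1 + 2 * enorm V)) g (u k).
    by near: k; exact: close e0.
  have := least_norm_stable _ _ _ _ _ (ltW e0) gu lV lVk.
  rewrite divfK ?gt_eqF// ge_min lexx => /(_ isT) /le_trans; apply.
  have : r <= d ^+ 2 / (8 * (1 + enorm V ^+ 2)) by rewrite ge_min lexx orbT.
  by rewrite ler_pdivlMr//; lra.
Unshelve. all: by end_near. Qed.
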